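(* Let $\phi:\mathcal{H}\rightarrow\mathbb{R}$ be a convex and continuous function and let $\{\lambda_k\}_{k=0}^{\infty}\subset[\varepsilon,1+\rho_{\{U_i\}_{i=1}^m}-\varepsilon]$, where $\varepsilon>0$, be a sequence of positive numbers. Let $x^0\in\mathcal{H}$ and let $\{x^k\}_{k=0}^{\infty}$ be the sequence generated by the basic algorithm (defined in the context) with respect to $\{\lambda_k\}_{k=0}^{\infty}$, and suppose that it converges strongly to a point $x\in C$. Let $y^0=x^0$ and suppose that the sequence $\{y^k\}_{k=0}^{\infty}$, generated by the corresponding superiorized algorithm (defined in the context, with the same operators, the same $\{\lambda_k\}_{k=0}^\infty$ and the function $\phi$), converges strongly to a point $y\in C$. Suppose that there exists a strictly increasing sequence $\{\gamma_k\}_{k=0}^\infty$ of natural numbers such that $$\left\|T_{(\Omega_{\gamma_k},\omega_{\gamma_k})\lambda_{\gamma_k}}\Big(y^{\gamma_k}+\sum_{n=1}^{N_{\gamma_k}}\beta_{\gamma_k,n}v^{\gamma_k,n}\Big)-T_{(\Omega_{\gamma_k},\omega_{\gamma_k})\lambda_{\gamma_k}}\left(x^{\gamma_k}\right)\right\|\ge\left\|y^{\gamma_k}-x^{\gamma_k}\right\|$$ for each $k\in\mathbb{N}$. Then $\phi(y)\le\phi(x)$.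
   Context: $\mathbb{N}$ starts from $0$. $\mathcal{H}$ is a real Hilbert space with inner product $\langle\cdot,\cdot\rangle$ and induced norm $\|\cdot\|$; $Id$ is the identity operator; $\mathrm{Fix}\,T:=\{x\in\mathcal{H}\mid T(x)=x\}$. For an operator $T:\mathcal{H}\to\mathcal{H}$ and $\lambda\in[0,2]$, the $\lambda$-relaxation of $T$ is $T_\lambda:=(1-\lambda)Id+\lambda T$. An operator $T$ is firmly nonexpansive if $\langle T(x)-T(y),x-y\rangle\ge\|T(x)-T(y)\|^2$ for all $x,y\in\mathcal{H}$; it is $\lambda$-relaxed firmly nonexpansive if $T=U_\lambda$ for some firmly nonexpansive $U$. For convex $\phi:\mathcal{H}\to\mathbb{R}$, the subdifferential at $x$ is $\partial\phi(x):=\{g\in\mathcal{H}\mid\langle g,y-x\rangle\le\phi(y)-\phi(x)\text{ for all }y\in\mathcal{H}\}$; it is nonempty for every $x$ when $\phi$ is convex and continuous. For a sequence of sets, $\limsup_{k\to\infty}A_k:=\bigcap_{n=0}^\infty\bigcup_{k=n}^\infty A_k$. Setting. Let $m$ be a positive integer and, for each $i=1,\dots,m$, let $U_i:\mathcal{H}\to\mathcal{H}$ be $\alpha_i$-relaxed firmly nonexpansive with $\alpha_i\in(0,2]$. Let $\{q_k\}_{k=0}^\infty$ be a bounded sequence of positive integers, $\mathcal{M}:=\max_{k\in\mathbb{N}}q_k$, and $$\rho_{\{U_i\}_{i=1}^m}:=\min\left\{\mathcal{M}^{-1}\min_{i\in\{1,\dots,m\}}(2-\alpha_i)\alpha_i^{-1},\,1\right\}.$$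 For each $k\in\mathbb{N}$, let $\Omega_k$ be a nonempty set of functions from $\{1,\dots,q_k\}$ to $\{1,\dots,m\}$; for $t\in\Omega_k$ put $V_k[t]:=U_{t(q_k)}\cdots U_{t(2)}U_{t(1)}$ (composition); let $\omega_k:\Omega_k\to(0,1]$ satisfy $\sum_{t\in\Omega_k}\omega_k(t)=1$; and define $T_{(\Omega_k,\omega_k)}:=\sum_{t\in\Omega_k}\omega_k(t)V_k[t]$. The operator $T_{(\Omega_k,\omega_k)\lambda_k}$ is the $\lambda_k$-relaxation of $T_{(\Omega_k,\omega_k)}$, i.e. $(1-\lambda_k)Id+\lambda_kT_{(\Omega_k,\omega_k)}$. Let $I:=\limsup_{k\to\infty}\{T_{(\Omega_k,\omega_k)}\}$ (the limsup of the sequence of singletons) and $C:=\bigcap_{T\in I}\mathrm{Fix}\,T$ (with $C=\mathcal{H}$ if $I=\emptyset$). Basic algorithm. Given $x^0\in\mathcal{H}$ and $\lambda_k\in[\varepsilon,1+\rho_{\{U_i\}_{i=1}^m}-\varepsilon]$ for each $k\in\mathbb{N}$ (with $\varepsilon\in(0,1]$), $$x^{k+1}:=x^k+\lambda_k\left(T_{(\Omega_k,\omega_k)}(x^k)-x^k\right),\quad k\in\mathbb{N}.$$ Superiorized algorithm. Given $y^0\in\mathcal{H}$, a sequence $\{N_k\}_{k=0}^\infty$ of positive integers, the positive numbers $\{\lambda_k\}_{k=0}^\infty$, and positive reals $\beta_{k,n}$ ($k\in\mathbb{N}$, $1\le n\le N_k$) with $\sum_{k=0}^\infty\sum_{n=1}^{N_k}\beta_{k,n}<\infty$,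 $$y^{k+1}:=y^k+\sum_{n=1}^{N_k}\beta_{k,n}v^{k,n}+\lambda_k\left(T_{(\Omega_k,\omega_k)}\Big(y^k+\sum_{n=1}^{N_k}\beta_{k,n}v^{k,n}\Big)-y^k-\sum_{n=1}^{N_k}\beta_{k,n}v^{k,n}\right),$$ where, for each $k\in\mathbb{N}$ and $n=0,1,\dots,N_k-1$, $s^{k,n}$ is a selected element of $\partial\phi\big(y^k+\sum_{i=1}^{n}\beta_{k,i}v^{k,i}\big)$ (empty sums are $0$), and $v^{k,n+1}:=-\|s^{k,n}\|^{-1}s^{k,n}$ if $0\notin\partial\phi\big(y^k+\sum_{i=1}^{n}\beta_{k,i}v^{k,i}\big)$, while $v^{k,n+1}:=0$ if $0\in\partial\phi\big(y^k+\sum_{i=1}^{n}\beta_{k,i}v^{k,i}\big)$. *)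

(* Defs.v *)
From HB Require Import structures.
From mathcomp Require Import all_boot all_order all_algebra.
From mathcomp Require Import all_classical all_reals all_analysis.

Set Implicit Arguments.
Unset Strict Implicit.
Unset Printing Implicit Defensive.

Import Order.TTheory GRing.Theory Num.Theory.
Import numFieldNormedType.Exports.

Local Open Scope classical_set_scope.
Local Open Scope ring_scope.

(* The default value is returned only when A has no greatest (least) element. *)
Definition maximum (A : set nat) : nat :=
  xget 0%N [set M | A M /\ ubound A M].

Definition minimum (R : realType) (A : set R) : R :=
  xget 0 [set a | A a /\ lbound A a].

(* A complete normed module over the reals with a dot product satisfying this
   predicate is a real Hilbert space. *)
Definition induces_norm (R : realType) (H : completeNormedModType R)
    (ip : {dot H for idfun}) : Prop :=
  forall x : H, `|x| = Num.sqrt (ip x x).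

Definition Fix (X : Type) (T : X -> X) : set X := [set x | T x = x].

Definition relax (R : realType) (H : completeNormedModType R)
    (lambda : R) (T : H -> H) : H -> H :=
  fun x => (1 - lambda) *: x + lambda *: T x.

Definition firmly_nonexpansive (R : realType) (H : completeNormedModType R)
    (ip : {dot H for idfun}) (T : H -> H) : Prop :=
  forall x y : H, ip (T x - T y) (x - y) >= `|T x - T y| ^+ 2.

Definition relaxed_firmly_nonexpansive (R : realType)
    (H : completeNormedModType R) (ip : {dot H for idfun})
    (lambda : R) (T : H -> H) : Prop :=
  exists U : H -> H, firmly_nonexpansive ip U /\ T = relax lambda U.

Definition subdifferential (R : realType) (H : completeNormedModType R)
    (ip : {dot H for idfun}) (phi : H -> R) (x : H) : set H :=
  [set g | forall y : H, ip g (y - x) <= phi y - phi x].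

Definition rho (R : realType) (m : nat) (q : nat -> nat) (alpha : 'I_m -> R) : R :=
  Num.min
    ((maximum (range q))%:R^-1 *
       minimum (range (fun i : 'I_m => (2 - alpha i) * (alpha i)^-1)))
    1.

(* Indices start at 0 and [codom t] lists t(0), t(1), ..., so that U_(t(0)) is
   applied first. *)
Definition string_op (H : Type) (m q : nat) (U : 'I_m -> H -> H)
    (t : {ffun 'I_q -> 'I_m}) : H -> H :=
  fun x => foldl (fun z i => U i z) x (codom t).

Definition string_avg (R : realType) (H : completeNormedModType R) (m q : nat)
    (U : 'I_m -> H -> H) (Omega : {set {ffun 'I_q -> 'I_m}})
    (omega : {ffun 'I_q -> 'I_m} -> R) : H -> H :=
  fun x => \sum_(t in Omega) omega t *: string_op U t x.

(* Equal to the whole space when the upper limit is empty. *)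
Definition limsup_fix (X : Type) (T : nat -> X -> X) : set X :=
  \bigcap_(S in lim_sup_set (fun k => [set T k])) Fix S.

Definition basic_algorithm (R : realType) (H : completeNormedModType R)
    (T : nat -> H -> H) (lambda : nat -> R) (x : nat -> H) : Prop :=
  forall k, x k.+1 = x k + lambda k *: (T k (x k) - x k).

Definition perturb (R : realType) (H : completeNormedModType R)
    (beta : nat -> nat -> R) (v : nat -> nat -> H) (y : nat -> H)
    (k n : nat) : H :=
  y k + \sum_(1 <= i < n.+1) beta k i *: v k i.

Definition superiorized_algorithm (R : realType) (H : completeNormedModType R)
    (ip : {dot H for idfun}) (phi : H -> R) (T : nat -> H -> H)
    (lambda : nat -> R) (N : nat -> nat) (beta : nat -> nat -> R)
    (s v : nat -> nat -> H) (y : nat -> H) : Prop :=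
  forall k,
    (forall n, (n < N k)%N ->
       let D := subdifferential ip phi (perturb beta v y k n) in
       D (s k n) /\
       v k n.+1 = if 0 \in D then 0 else - (`|s k n|^-1 *: s k n)) /\
    let z := perturb beta v y k (N k) in
    y k.+1 = z + lambda k *: (T k z - z).

(* Main.v *)
(* Each T_k is strongly nonexpansive with constant at least rho, so its
   lambda_k-relaxation is nonexpansive; hence the inequality along gamma gives
   |z_k - x_k| >= |y_k - x_k| infinitely often, where z_k is the perturbed y_k.
   If phi x < phi y, then for large k every point near x_k has a smaller value
   of phi than every point near y_k, so each short normalized subgradient step
   strictly decreases the distance to x_k, whence |z_k - x_k| < |y_k - x_k|, a
   contradiction. *)
Require Import Defs.
From HB Require Import structures.
From mathcomp Require Import all_boot all_order all_algebra.
From mathcomp Require Import all_classical all_reals all_analysis.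
From mathcomp Require Import ring lra.

Set Implicit Arguments.
Unset Strict Implicit.
Unset Printing Implicit Defensive.

Import Order.TTheory GRing.Theory Num.Theory.
Import numFieldNormedType.Exports.

Local Open Scope classical_set_scope.
Local Open Scope ring_scope.

(** * Extremal values of bounded sets of naturals and of finite families *)

Lemma maximum_ge (A : set nat) (B n : nat) :
  ubound A B -> A n -> (n <= maximum A)%N.
Proof.
move=> AB An; rewrite /maximum.
have exA : exists i, `[< A i >] by exists n; apply/asboolP.
have leA i : `[< A i >] -> (i <= B)%N by move=> /asboolP /AB.
case: (ex_maxnP exA leA) => i /asboolP Ai imax.
(* The default branch of [xget] is contradictory, because [i] is a greatest element of [A]. *)
case: xgetP => [M _ [_ /(_ _ An)] //|/(_ i)[]].
by split=> // j Aj; apply/imax/asboolP.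
Qed.

Section MinimumOverFinite.
Variables (R : realType) (I : finType) (f : I -> R).

Lemma minimum_le i : minimum (range f) <= f i.
Proof.
rewrite /minimum; case: xgetP => [a _ [_ /(_ (f i))]|]; first by apply; exists i.
case: (@arg_minP _ _ _ i predT f) => // j _ jmin /(_ (f j))[].
by split=> [|_ [k _ <-]]; [exists j|exact: jmin].
Qed.

(** Either the minimum is a value of [f], or it is the default value 0. *)
Lemma minimum_ge0 : (forall i, 0 <= f i) -> 0 <= minimum (range f).
Proof. by move=> f0; rewrite /minimum; case: xgetP => [_ -> [[i _ <-] _]|]. Qed.

End MinimumOverFinite.

(** * Inner product identities and Jensen's inequality for the squared norm *)

Section Hilbert.
Variables (R : realType) (H : completeNormedModType R) (ip : {dot H for idfun}).

Lemma ipC u v : ip u v = ip v u.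
Proof. by rewrite hermC mul1r. Qed.

Lemma ip_ge0 u : 0 <= ip u u.
Proof.
have [->|u0] := eqVneq u 0; first by rewrite linear0r.
by rewrite ltW// neq0_dnorm_gt0.
Qed.

Lemma ipZl a u v : ip (a *: u) v = a * ip u v.
Proof. by rewrite linearZl_LR. Qed.

Lemma ipZr a u v : ip u (a *: v) = a * ip u v.
Proof. by rewrite linearZr_LR. Qed.

Lemma ip_sqrB u v : ip (u - v) (u - v) = ip u u - 2 * ip u v + ip v v.
Proof. by rewrite linearBl !linearBr/= (ipC v u); ring. Qed.

Lemma ip_sqrD u v : ip (u + v) (u + v) = ip u u + 2 * ip u v + ip v v.
Proof. by rewrite linearDl !linearDr/= (ipC v u); ring. Qed.

Lemma ip_normE : induces_norm ip -> forall u, ip u u = `|u| ^+ 2.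
Proof. by move=> hip u; rewrite hip sqr_sqrtr// ip_ge0. Qed.

(** The difference of the two sides is the weighted variance of [g] about its mean, which is
    nonnegative. *)
Lemma ip_jensen (I : finType) (A : {set I}) (w : I -> R) (g : I -> H) :
    (forall i, i \in A -> 0 <= w i) -> \sum_(i in A) w i = 1 ->
  ip (\sum_(i in A) w i *: g i) (\sum_(i in A) w i *: g i) <=
  \sum_(i in A) w i * ip (g i) (g i).
Proof.
move=> w0 w1; set gw := \sum_(i in A) _.
have : 0 <= \sum_(i in A) w i * ip (g i - gw) (g i - gw).
  by apply: sumr_ge0 => i iA; rewrite mulr_ge0 ?w0 ?ip_ge0.
have -> : \sum_(i in A) w i * ip (g i - gw) (g i - gw) =
    \sum_(i in A) w i * ip (g i) (g i) - ip gw gw.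
  have gwl : ip gw gw = \sum_(i in A) w i * ip (g i) gw.
    by rewrite {1}/gw linear_sumlz/=; apply: eq_bigr => i _; rewrite ipZl.
  have gw1 : ip gw gw = \sum_(i in A) w i * ip gw gw.
    by rewrite -mulr_suml w1 mul1r.
  transitivity (\sum_(i in A) w i * ip (g i) (g i) - 2 * ip gw gw + ip gw gw);
    last by ring.
  rewrite {1}gwl gw1 mulr_sumr -sumrB -big_split/=; apply: eq_bigr => i _.
  by rewrite ip_sqrB; ring.
by rewrite subr_ge0.
Qed.

(** * Strong nonexpansiveness of relaxations, strings and averages *)

Definition strongly_nonexpansive (c : R) (T : H -> H) :=
  forall x y,
  c * ip (x - y - (T x - T y)) (x - y - (T x - T y)) <=
  ip (x - y) (x - y) - ip (T x - T y) (T x - T y).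

(* The right-hand side is linear in [e] up to one square, so that it survives
   averaging by Jensen's inequality. *)
Lemma displacementE (c : R) (d e : H) :
  (c * ip (d - e) (d - e) <= ip d d - ip e e) =
  ((1 + c) * ip (d - e) (d - e) <= 2 * ip d (d - e)).
Proof. by apply/idP/idP; rewrite ip_sqrB linearBr/=; lra. Qed.

Lemma relaxB (a : R) (T : H -> H) x y :
  relax a T x - relax a T y = (x - y) - a *: ((x - y) - (T x - T y)).
Proof.
rewrite /relax opprD addrACA -!scalerBr [in RHS]scalerBr scalerBl scale1r.
by rewrite opprB addrA addrAC.
Qed.

(** With [d = x - y] and [f = F x - F y], firm nonexpansiveness reads |d - f|^2 <= <d, d - f>. The
    displacement of the relaxation is a(d - f), so the claim is this inequality multiplied by 2a. *)
Lemma relaxed_strongly_nonexpansive (a : R) (T : H -> H) :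
  induces_norm ip -> 0 < a -> relaxed_firmly_nonexpansive ip a T ->
  strongly_nonexpansive ((2 - a) * a^-1) T.
Proof.
move=> hip a0 [F [hF ->]] x y.
have := hF x y; rewrite -(ip_normE hip) !relaxB.
move: (x - y) (F x - F y) => d f fd.
rewrite subKr (ip_sqrB d (a *: _)) !(ipZl, ipZr).
have -> : (2 - a) / a * (a * (a * ip (d - f) (d - f))) =
    (2 - a) * a * ip (d - f) (d - f) by field; rewrite gt_eqF.
have : ip (d - f) (d - f) <= ip d (d - f).
  by move: fd; rewrite ip_sqrB linearBr/= (ipC f d); lra.
nra.
Qed.

(** Relaxation turns |d|^2 into |d|^2 - a(2<d, d - e> - a|d - e|^2), and the bracket is nonnegative
    by [displacementE] as long as a <= 1 + c. *)
Lemma relax_nonexpansive (c a : R) (T : H -> H) x y :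
  induces_norm ip -> strongly_nonexpansive c T -> 0 <= a <= 1 + c ->
  `|relax a T x - relax a T y| <= `|x - y|.
Proof.
move=> hip hT /andP[a0 ac]; rewrite !hip ler_sqrt ?ip_ge0//.
have := hT x y; rewrite displacementE relaxB.
move: (x - y) (T x - T y) => d e cde.
rewrite (ip_sqrB d (a *: _)) !(ipZl, ipZr).
have : a * ip (d - e) (d - e) <= 2 * ip d (d - e).
  by apply: le_trans _ cde; rewrite ler_wpM2r ?ip_ge0.
by move=> /(ler_wpM2l a0); lra.
Qed.

(* [S] is the sum of the squared displacement differences of the successive
   factors. *)
Lemma foldl_displacement (c : R) (I : Type) (U : I -> H -> H) :
  (forall i, strongly_nonexpansive c (U i)) ->
  forall (l : seq I) x y,
  let e := foldl (fun z i => U i z) x l - foldl (fun z i => U i z) y l in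
  let d := x - y in
  exists2 S, c * S <= ip d d - ip e e &
    0 <= S /\ ip (d - e) (d - e) <= (size l)%:R * S.
Proof.
move=> hU; elim=> [|i l IH] x y /=.
  by exists 0; rewrite ?subrr ?linear0r ?mulr0.
have := IH (U i x) (U i y); have := hU i x y; rewrite /=.
set d := x - y; set d1 := U i x - U i y; set e := foldl _ _ _ - _.
move=> h1 [S cS [S0 hS]]; exists (S + ip (d - d1) (d - d1)); first lra.
split; first by rewrite addr_ge0 ?ip_ge0.
have -> : d - e = (d - d1) + (d1 - e) by rewrite addrA subrK.
move: (d - d1) (d1 - e) hS => g1 g2 hS.
rewrite ip_sqrD mulrS.
(* An empty tail is treated apart, since the general case cancels the factor [size l]. *)
have [n0|n0] := posnP (size l).
  have /eqP g20 : g2 == 0.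
    apply: contraT => /neq0_dnorm_gt0 -/(_ _ ip).
    by rewrite ltNge (le_trans hS)// n0 mul0r.
  by rewrite g20 !linear0r n0; lra.
have {}n0 : 0 < (size l)%:R :> R by rewrite ltr0n.
(* With n = [size l], expanding |n g1 - g2|^2 >= 0 and using |g2|^2 <= n S gives 2<g1, g2> <=
   n|g1|^2 + S, hence |g1 + g2|^2 <= (n + 1)(|g1|^2 + S). *)
move: (ip_ge0 ((size l)%:R *: g1 - g2)); rewrite ip_sqrB !(ipZl, ipZr) => h.
have : (size l)%:R * (2 * ip g1 g2) <=
    (size l)%:R * ((size l)%:R * ip g1 g1 + S) by nra.
by rewrite ler_pM2l//; lra.
Qed.

(** The squared total displacement is at most q S <= M S, while c S bounds the decrease from below.
    Using the common bound [M] gives one constant for strings of all lengths. *)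
Lemma string_op_strongly_nonexpansive (c : R) (m q M : nat) (U : 'I_m -> H -> H)
    (t : {ffun 'I_q -> 'I_m}) :
  0 <= c -> (0 < M)%N -> (q <= M)%N ->
  (forall i, strongly_nonexpansive c (U i)) ->
  strongly_nonexpansive (M%:R^-1 * c) (string_op U t).
Proof.
move=> c0 M0 qM hU x y; set d := x - y; set e := string_op U t x - string_op U t y.
have [S cS [S0]] := foldl_displacement hU (codom t) x y.
rewrite /= -/d -/e size_codom card_ord => hS; apply: le_trans cS.
rewrite mulrAC mulrC ler_wpM2l// mulrC ler_pdivrMr ?ltr0n// mulrC.
by rewrite (le_trans hS)// ler_wpM2r// ler_nat.
Qed.

(** In the form of [displacementE], averaging over [t] preserves the linear right-hand side, and
    Jensen's inequality handles the left-hand side because 1 + c >= 0. *)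
Lemma string_avg_strongly_nonexpansive (c : R) (m q : nat) (U : 'I_m -> H -> H)
    (Omega : {set {ffun 'I_q -> 'I_m}}) (omega : {ffun 'I_q -> 'I_m} -> R) :
  -1 <= c ->
  (forall t, t \in Omega -> 0 <= omega t) -> \sum_(t in Omega) omega t = 1 ->
  (forall t : {ffun 'I_q -> 'I_m},
     strongly_nonexpansive c (string_op U t)) ->
  strongly_nonexpansive c (string_avg U Omega omega).
Proof.
move=> c1 w0 w1 hU x y; set d := x - y.
set e := string_avg U Omega omega x - string_avg U Omega omega y.
pose et (t : {ffun 'I_q -> 'I_m}) := string_op U t x - string_op U t y.
have eE : e = \sum_(t in Omega) omega t *: et t.
  by rewrite /e /string_avg -sumrB; apply: eq_bigr => t _; rewrite scalerBr.
have deE : d - e = \sum_(t in Omega) omega t *: (d - et t).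
  rewrite eE -[d in LHS]scale1r -w1 scaler_suml -sumrB.
  by apply: eq_bigr => t _; rewrite -scalerBr.
have := ip_jensen (fun t => d - et t) w0 w1; rewrite /= -deE => J.
have : \sum_(t in Omega) omega t * ((1 + c) * ip (d - et t) (d - et t)) <=
    \sum_(t in Omega) omega t * (2 * ip d (d - et t)).
  apply: ler_sum => t /w0 wt; apply: ler_wpM2l => //.
  by rewrite -displacementE; exact: hU.
have -> : \sum_(t in Omega) omega t * (2 * ip d (d - et t)) = 2 * ip d (d - e).
  rewrite deE linear_sumr mulr_sumr; apply: eq_bigr => t _.
  by rewrite /= ipZr; ring.
have -> : \sum_(t in Omega) omega t * ((1 + c) * ip (d - et t) (d - et t)) =
    (1 + c) * \sum_(t in Omega) omega t * ip (d - et t) (d - et t).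
  by rewrite mulr_sumr; apply: eq_bigr => t _; ring.
have : (1 + c) * ip (d - e) (d - e) <=
    (1 + c) * \sum_(t in Omega) omega t * ip (d - et t) (d - et t).
  by rewrite ler_wpM2l//; lra.
by rewrite displacementE => /le_trans h /h.
Qed.

(** * Normalized subgradient steps towards a ball of lower values *)

(** For the unit subgradient direction n, the ball of lower values forces <n, w - u> >= r. The
    squared distance then changes by b^2 - 2b<n, w - u> <= b(b - 2r) < 0. *)
Lemma subgradient_step (phi : H -> R) (s w u : H) (r b : R) :
  induces_norm ip -> s != 0 ->
  subdifferential ip phi w s ->
  0 < b < 2 * r ->
  (forall p, `|p| <= r -> phi (u + p) <= phi w) ->
  `|w + b *: - (`|s|^-1 *: s) - u| < `|w - u|.
Proof.
move=> hip s0 sw /andP[b0 br] hu.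
have ns0 : 0 < `|s| by rewrite normr_gt0.
set n := `|s|^-1 *: s.
have nn : ip n n = 1.
  by rewrite ipZl ipZr ip_normE// expr2; field; rewrite gt_eqF.
have sE : s = `|s| *: n by rewrite scalerA divff ?gt_eqF// scale1r.
clearbody n.
(* The subgradient inequality is tested at [u + r *: n], which yields the
   margin [r]. *)
have hn : r <= ip n (w - u).
  have un : phi (u + r *: n) <= phi w.
    by apply: hu; rewrite hip ipZl ipZr nn mulr1 -expr2 sqrtr_sqr ger0_norm; lra.
  have : ip s (u + r *: n - w) <= 0.
    by apply: le_trans (sw _) _; rewrite subr_le0.
  rewrite sE ipZl pmulr_rle0// addrAC linearDr/= ipZr nn mulr1.
  by rewrite -(opprB w u) linearNr/=; lra.
rewrite !hip ltr_sqrt.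
  rewrite scalerN addrAC (ip_sqrB (w - u)) ipZl !ipZr nn (ipC (w - u)); nra.
(* Strict monotonicity of the square root needs w != u, which holds because [hn] would otherwise
   give r <= 0. *)
rewrite neq0_dnorm_gt0//; apply: contraTneq hn => ->.
by rewrite linear0r -ltNge; lra.
Qed.

(** Directions have norm at most 1 and the step sizes sum to at most [r], so all intermediate points
    stay within [r] of [y k]. There [phi] exceeds its values on the ball about [u], and
    [subgradient_step] applies to each step. *)
Lemma perturb_closer (phi : H -> R) (beta : nat -> nat -> R)
    (s v : nat -> nat -> H) (y : nat -> H) (k N : nat) (u : H) (r : R) :
  induces_norm ip -> (0 < N)%N ->
  (forall n, (1 <= n <= N)%N -> 0 < beta k n) ->
  \sum_(1 <= n < N.+1) beta k n <= r ->
  (forall n, (n < N)%N ->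
     let D := subdifferential ip phi (perturb beta v y k n) in
     D (s k n) /\ v k n.+1 = if 0 \in D then 0 else - (`|s k n|^-1 *: s k n)) ->
  (forall p w, `|p| <= r -> `|w - y k| <= r -> phi (u + p) < phi w) ->
  `|perturb beta v y k N - u| < `|y k - u|.
Proof.
move=> hip N0 b0 br sv hphi.
have v1 n : (n < N)%N -> `|v k n.+1| <= 1.
  move=> /sv[_ ->]; case: ifP => _; first by rewrite normr0.
  rewrite normrN normrZ normfV normr_id.
  by have [->|s0] := eqVneq `|s k n| 0; rewrite ?mulr0// mulVf.
have near_y n : (n <= N)%N -> `|perturb beta v y k n - y k| <= r.
  move=> nN; rewrite /perturb addrAC subrr add0r (le_trans (ler_norm_sum _ _ _))//.
  apply: le_trans br; rewrite [leRHS](big_cat_nat (n := n.+1))//=.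
  rewrite -[leLHS]addr0 lerD//; last first.
    rewrite big_nat_cond sumr_ge0// => i /andP[/andP[ni iN] _].
    by rewrite ltW// b0// (leq_trans _ ni).
  rewrite !big_nat; apply: ler_sum => -[//|i] /andP[_ in1].
  have iN : (i < N)%N by apply: leq_trans nN.
  have bi : 0 < beta k i.+1 by rewrite b0.
  by rewrite normrZ gtr0_norm// ger_pMr// v1.
have step n : (n < N)%N ->
    `|perturb beta v y k n.+1 - u| < `|perturb beta v y k n - u|.
  move=> nN; have bn : 0 < beta k n.+1 by rewrite b0.
  have bnr : beta k n.+1 <= r.
    apply: le_trans br.
    rewrite (bigD1_seq n.+1) ?mem_index_iota ?iota_uniq//= lerDl.
    rewrite big_nat_cond sumr_ge0// => i /andP[/andP[i0 iN] _].
    by rewrite ltW// b0// i0.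
  have r0 : 0 < r := lt_le_trans bn bnr.
  have hw p : `|p| <= r -> phi (u + p) < phi (perturb beta v y k n).
    by move=> pr; apply: hphi => //; rewrite near_y// ltnW.
  (* A zero subgradient would make the current point a minimizer of [phi], but [phi u] is smaller;
     hence the direction is the normalized one. *)
  have D0 : ~ subdifferential ip phi (perturb beta v y k n) 0.
    move=> /(_ u); rewrite linear0l leNgt subr_lt0.
    by rewrite -{1}[u]addr0 hw// normr0 ltW.
  have [sD vE] := sv _ nN.
  have -> : perturb beta v y k n.+1 =
      perturb beta v y k n + beta k n.+1 *: - (`|s k n|^-1 *: s k n).
    by rewrite /perturb big_nat_recr//= addrA vE memNset.
  apply: (@subgradient_step phi _ _ _ r) => //; last 2 first.
  - by rewrite bn /=; lra.
  - by move=> p /hw /ltW.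
  - by apply: contra_notN D0 => /eqP s0; move: sD; rewrite s0.
(* Strictness requires at least one step, so the induction starts with the first step and uses 0 <
   N. *)
suff closer n : (n < N)%N -> `|perturb beta v y k n.+1 - u| < `|y k - u|.
  by rewrite -(prednK N0) closer// prednK.
elim: n => [|n IH] nN; last exact: lt_trans (step _ nN) (IH (ltnW nN)).
by rewrite (lt_le_trans (step _ nN))// /perturb big_geq// addr0.
Qed.

End Hilbert.

Theorem corollary3p3 (R : realType) (H : completeNormedModType R)
    (ip : {dot H for idfun}) (hip : induces_norm ip)
    (m : nat) (hm : (0 < m)%N)
    (U : 'I_m -> H -> H) (alpha : 'I_m -> R)
    (halpha : forall i, 0 < alpha i <= 2)
    (hU : forall i, relaxed_firmly_nonexpansive ip (alpha i) (U i))
    (q : nat -> nat) (hq0 : forall k, (0 < q k)%N)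
    (hqb : exists B : nat, forall k, (q k <= B)%N)
    (Omega : forall k, {set {ffun 'I_(q k) -> 'I_m}})
    (hOmega : forall k, exists t, t \in Omega k)
    (omega : forall k, {ffun 'I_(q k) -> 'I_m} -> R)
    (homega : forall k t, t \in Omega k -> 0 < omega k t <= 1)
    (homega1 : forall k, \sum_(t in Omega k) omega k t = 1)
    (T := fun k => string_avg U (Omega k) (omega k))
    (phi : H -> R)
    (hphi : convex_function (E := H) setT phi) (hphic : continuous phi)
    (eps : R) (heps : 0 < eps)
    (lambda : nat -> R)
    (hlambda0 : forall k, 0 < lambda k)
    (hlambda : forall k, eps <= lambda k <= 1 + rho q alpha - eps)
    (x_ : nat -> H) (hx : basic_algorithm T lambda x_)
    (x : H) (hxC : limsup_fix T x) (hxlim : x_ @ \oo --> x)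
    (N : nat -> nat) (hN : forall k, (0 < N k)%N)
    (beta : nat -> nat -> R)
    (hbeta : forall k n, (1 <= n <= N k)%N -> 0 < beta k n)
    (hbetas : cvgn (series (fun k => \sum_(1 <= n < (N k).+1) beta k n)))
    (s v : nat -> nat -> H) (y_ : nat -> H)
    (hy0 : y_ 0%N = x_ 0%N)
    (hy : superiorized_algorithm ip phi T lambda N beta s v y_)
    (y : H) (hyC : limsup_fix T y) (hylim : y_ @ \oo --> y)
    (gamma : nat -> nat) (hgamma : increasing_seq gamma)
    (hge : forall k, let g := gamma k in
       `| relax (lambda g) (T g) (y_ g + \sum_(1 <= n < (N g).+1) beta g n *: v g n)
          - relax (lambda g) (T g) (x_ g) | >= `| y_ g - x_ g |) :
  phi y <= phi x.
Proof.
have [B qB] := hqb.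
have qM k : (q k <= maximum (range q))%N.
  by apply: (@maximum_ge _ B) => [_ [i _ <-]//|]; exists k.
have M0 : (0 < maximum (range q))%N by apply: leq_trans (hq0 0%N) (qM 0%N).
set M := maximum _ in qM M0.
set mu := minimum (range (fun i => (2 - alpha i) / alpha i)).
have mu0 : 0 <= mu.
  apply: minimum_ge0 => i; have /andP[a0 a2] := halpha i.
  by rewrite divr_ge0 ?subr_ge0// ltW.
have hUmu i : strongly_nonexpansive ip mu (U i).
  move=> a b; have /andP[a0 _] := halpha i.
  apply: le_trans (relaxed_strongly_nonexpansive hip a0 (hU i) a b).
  by rewrite ler_wpM2r ?ip_ge0// (minimum_le (fun i => (2 - alpha i) / alpha i)).
have Mmu0 : 0 <= M%:R^-1 * mu by rewrite mulr_ge0// invr_ge0.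
have hT k : strongly_nonexpansive ip (M%:R^-1 * mu) (T k).
  apply: string_avg_strongly_nonexpansive => //.
  - by rewrite (le_trans _ Mmu0)// lerN10.
  - by move=> t /homega /andP[/ltW].
  - by move=> t; apply: string_op_strongly_nonexpansive.
rewrite leNgt; apply/negP => phixy.
(* The midpoint [c] separates [phi x] from [phi y]; continuity at both points then provides the
   radius [r]. *)
have := midf_lt phixy; set c := (_ + _) / 2 => -[xc cy].
have [r r0 phir] : exists2 r, 0 < r & forall a b,
    `|x - a| < r -> `|y - b| < r -> phi a < phi b.
  have /nbhs_ballP[r1 /= r10 h1] : \forall a \near x, phi a < c.
    exact: (cvgr_lt (phi x) (hphic x)).
  have /nbhs_ballP[r2 /= r20 h2] : \forall a \near y, c < phi a.
    exact: (cvgr_gt (phi y) (hphic y)).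
  exists (Num.min r1 r2); first by rewrite lt_min r10 r20.
  move=> a b; rewrite !lt_min => /andP[xa _] /andP[_ yb].
  apply: lt_trans (h1 _ _) (h2 _ _); by rewrite -ball_normE.
(* One half of [r] covers the distance of the iterates to their limits, the other the ball about
   [x_ k] and the total perturbation of [y_ k]. *)
have r20 : 0 < r / 2 by rewrite divr_gt0.
have [K _ hK] : \forall k \near \oo,
    [/\ `|x - x_ k| < r / 2, `|y - y_ k| < r / 2 &
    \sum_(1 <= n < (N k).+1) beta k n < r / 2].
  near=> k; split; near: k.
  - by move/cvgrPdist_lt : hxlim; apply.
  - by move/cvgrPdist_lt : hylim; apply.
  - exact: (cvgr_lt 0 (cvg_series_cvg_0 hbetas)).
(* A strictly increasing sequence of naturals satisfies n <= gamma n, so the index [gamma K] lies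
   beyond the threshold. *)
have gK : (K <= gamma K)%N.
  elim: (K) => // n /leq_ltn_trans; apply.
  by have /increasing_seqP := hgamma; apply.
have [] := hK _ gK; set g := gamma K => xg yg bg.
have /= := hge K; rewrite -/g leNgt => /negP; apply.
apply: (@le_lt_trans _ _ `|perturb beta v y_ g (N g) - x_ g|).
  apply: relax_nonexpansive (hT g) _ => //.
  (* The first entry of the minimum defining [rho] gives lambda_g <= 1 + M^-1 mu, the range in which
     relaxation is nonexpansive. *)
  have /andP[eg gr] := hlambda g; rewrite ltW//=.
  have : rho q alpha <= M%:R^-1 * mu by rewrite /rho ge_min lexx.
  by move=> ?; lra.
apply: (@perturb_closer _ _ ip phi beta s v y_ g (N g) (x_ g) (r / 2)) => //.
- exact: hbeta.
- exact: ltW.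
- by have [] := hy g.
- move=> p w pr wr; apply: phir.
    rewrite opprD addrA (le_lt_trans (ler_normB _ _))//.
    by rewrite [ltRHS]splitr ltr_leD.
  rewrite -[y](subrK (y_ g)) -addrA (le_lt_trans (ler_normD _ _))//.
  by rewrite [ltRHS]splitr ltr_leD// distrC.
Unshelve. all: by end_near.
Qed.
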